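(* Let $k\ge 2$ be an integer, let $\{F^{(k)}_n\}_{n\ge 0}$ be the $k$-generalized Fibonacci sequence, and let $\{G^{(k)}_n\}_{n\ge 0}$ be a $k$-generalized Fibonacci-like sequence of real numbers. Then for all natural numbers $n\ge k$, $$G^{(k)}_n = G^{(k)}_0 F^{(k)}_{n-1}+\sum_{m=0}^{k-3}\left(G^{(k)}_{m+1}\sum_{j=0}^{m+1} F^{(k)}_{n-1-j}\right) + G^{(k)}_{k-1}\,F^{(k)}_n .$$
   Context: For an integer $k\ge 2$, the $k$-generalized Fibonacci sequence is defined by $F^{(k)}_n=0$ for $0\le n<k-1$, $F^{(k)}_{k-1}=1$, and $F^{(k)}_n=\sum_{i=1}^k F^{(k)}_{n-i}$ for $n>k-1$. A $k$-generalized Fibonacci-like sequence $\{G^{(k)}_n\}_{n\ge0}$ has given initial values $G^{(k)}_0,\dots,G^{(k)}_{k-1}$, at least one of which is nonzero, and satisfies $G^{(k)}_n=\sum_{i=1}^k G^{(k)}_{n-i}$ for $n>k-1$. When $k=2$ the sum over $m$ from $0$ to $k-3$ is empty and equals $0$. *)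

(* Defs.v *)
From mathcomp Require Import all_boot all_order all_algebra.
From mathcomp Require Import reals.
Set Implicit Arguments.
Unset Strict Implicit.
Unset Printing Implicit Defensive.

Import GRing.Theory.
Local Open Scope ring_scope.

(* The list F_(n-1), ..., F_0: most recent term first, so that [take k] of it
   is the window of the k preceding terms. *)
Fixpoint kfib_seq (k n : nat) : seq nat :=
  if n is m.+1 then
    let s := kfib_seq k m in
    (if (m < k - 1)%N then 0%N
     else if m == (k - 1)%N then 1%N
     else sumn (take k s)) :: s
  else [::].

Definition kfib (k n : nat) : nat := head 0%N (kfib_seq k n.+1).

(* The recurrence is only required for n > k - 1, so the subtraction n - i
   with 1 <= i <= k never truncates. *)
Definition kfib_like (V : nmodType) (k : nat) (G : nat -> V) : Prop :=
  (exists2 i : nat, (i < k)%N & G i <> 0) /\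
  (forall n : nat, (k - 1 < n)%N -> G n = \sum_(1 <= i < k.+1) G (n - i)%N).

Lemma kfib_small (k n : nat) : (n < k - 1)%N -> kfib k n = 0%N.
Proof. by rewrite /kfib /= => ->. Qed.

Lemma kfib_one (k : nat) : kfib k (k - 1) = 1%N.
Proof. by rewrite /kfib /= ltnn eqxx. Qed.

Lemma kfib_seqE (k n : nat) :
  kfib_seq k n = [seq kfib k (n - i) | i <- iota 1 n].
Proof.
elim: n => [|n IHn] //.
have -> : kfib_seq k n.+1 = kfib k n :: kfib_seq k n by [].
rewrite IHn /= subSS subn0 (iotaDl 1 1) -map_comp; congr cons.
Qed.

Lemma kfib_rec (k n : nat) : (k - 1 < n)%N ->
  kfib k n = (\sum_(1 <= i < k.+1) kfib k (n - i))%N.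
Proof.
move=> lt_kn; rewrite {1}/kfib /= ltnNge ltnW //= gtn_eqF //.
have le_kn : (k <= n)%N by case: (k) lt_kn => // p; rewrite subn1.
by rewrite kfib_seqE -map_take take_iota (minn_idPl le_kn) sumnE big_map
  /index_iota subn1.
Qed.

(* Main.v *)
(** Put [c_i(n) = F_(n-1) + ... + F_(n-1-i)].  The recurrence for [F] gives
    [c_(k-1)(n) = F_n], so the right-hand side is [sum_(i<k) G_i c_i(n)].
    Since [c_i(n+1) = F_n + c_(i-1)(n)] and [G_k = G_0 + ... + G_(k-1)], its
    value at [n+1] equals its value at [n] for the shifted sequence
    [i |-> G_(i+1)], so one can induct on [n] for all sequences [G]
    simultaneously; at [n = k] all the [c_i] are 1. *)
Require Import Defs.
From mathcomp Require Import all_boot all_order all_algebra.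
From mathcomp Require Import reals.

Import GRing.Theory.
Local Open Scope ring_scope.

(** This is c_i(n) for order [k]; as long as i < k <= n, none of the subtractions truncates. *)
Definition kfib_window (k n i : nat) : nat :=
  (\sum_(0 <= j < i.+1) kfib k (n - 1 - j))%N.

Lemma kfib_window0 (k n : nat) : kfib_window k n 0 = kfib k (n - 1).
Proof. by rewrite /kfib_window big_nat1 subn0. Qed.

Lemma kfib_windowS (k n i : nat) :
  kfib_window k n.+1 i.+1 = (kfib k n + kfib_window k n i)%N.
Proof.
rewrite /kfib_window big_nat_recl // subn1 subn0; congr addn.
by apply: eq_bigr => j _; rewrite -subnDA add1n.
Qed.

Lemma kfib_window_full (k n : nat) :
  (k < n)%N -> kfib_window k.+1 n k = kfib k.+1 n.
Proof.
move=> lt_kn; rewrite kfib_rec ?subn1 // big_add1.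
by apply: eq_bigr => j _; rewrite -subnDA.
Qed.

(** The window opens at F_(k-1) = 1, and all its later terms lie in the initial block of zeros. *)
Lemma kfib_window_start (k i : nat) : (i < k)%N -> kfib_window k k i = 1%N.
Proof.
move=> lt_ik; rewrite /kfib_window big_nat_recl // subn0 kfib_one.
rewrite big_nat big1 ?addn0 // => j lt_ji; apply: kfib_small.
by rewrite ltn_subrL subn_gt0 (leq_ltn_trans _ lt_ik) //; case: (i) lt_ji.
Qed.

(** Only sums and natural multiples of the G_i occur, so the values may lie in any commutative
    additive monoid. The order is [k.+1]. *)
Lemma kfib_rec_window (V : nmodType) (k n : nat) (G : nat -> V) :
  (forall m, (k < m)%N -> G m = \sum_(1 <= i < k.+2) G (m - i)%N) ->
  (k < n)%N ->
  G n = \sum_(0 <= i < k.+1) G i *+ kfib_window k.+1 n i.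
Proof.
move=> recG lt_kn; have Gk : G k.+1 = \sum_(0 <= i < k.+1) G i.
  by rewrite recG // big_add1 [RHS]big_nat_rev.
elim: n lt_kn G recG Gk => // n IHn; rewrite ltnS leq_eqVlt.
case/predU1P=> [<-|lt_kn] G recG Gk.
  rewrite Gk !big_mkord; apply: eq_bigr => i _.
  by rewrite kfib_window_start.
have recGS m : (k < m)%N -> G m.+1 = \sum_(1 <= i < k.+2) G (m - i).+1.
  move=> lt_km; rewrite recG ?leqW //.
  by apply: eq_big_nat => i /andP[_ le_ik]; rewrite subSn // (leq_trans _ lt_km).
rewrite (IHn lt_kn (fun i => G i.+1)) //; last first.
  by rewrite recGS // big_add1 [RHS]big_nat_rev.
(* The top term is G_(k+1) F_n. Expanding G_(k+1) gives every G_i one F_n: this is c_0(n+1) for i =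
   0 and raises c_(i-1)(n) to c_i(n+1) for i > 0. *)
rewrite big_nat_recr //= kfib_window_full // Gk.
rewrite [RHS]big_nat_recl // [in X in _ + X]big_nat_recl //.
rewrite mulrnDl addrCA kfib_window0 subn1.
congr (_ + _); rewrite -sumrMnl -big_split /=.
by apply: eq_bigr => i _; rewrite kfib_windowS mulrnDr addrC.
Qed.

Theorem theorem2p2 (R : realType) (k : nat) (hk : (2 <= k)%N)
    (G : nat -> R) (hG : kfib_like k G) (n : nat) (hn : (k <= n)%N) :
  G n = G 0%N * (kfib k (n - 1))%:R
        + \sum_(0 <= m < k - 2)
            (G m.+1 * \sum_(0 <= j < m.+2) (kfib k (n - 1 - j))%:R)
        + G (k - 1)%N * (kfib k n)%:R.
Proof.
case: hG => _; case: k hk hn => [|[|k]] // _ lt_kn; rewrite !subSS !subn0.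
move=> recG; rewrite (kfib_rec_window _ _ _ _ recG lt_kn).
(* The first and last coefficients collapse to F_(n-1) and F_n; the middle terms match under i = m +
   1. *)
rewrite big_nat_recl // big_nat_recr //= addrA.
rewrite kfib_window0 kfib_window_full // !mulr_natr.
congr (_ + _ + _); apply: eq_bigr => m _.
by rewrite -natr_sum mulr_natr.
Qed.
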